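(* Let $1\le p<+\infty$ and let $x^{*}:l^{p}_{\mathbb{R}_{\mathcal F}}\to\mathbb{R}$ be a map. Then $x^{*}$ is a linear and continuous functional (continuity with respect to the metric $\rho_p$) if and only if there exists a linear functional $L:S^{p}\overline{C}[0,1]\to\mathbb{R}$ such that $$x^{*}(x)=L(x_{-}+x_{+})\quad\text{for all } x=(x_n)_n\in l^{p}_{\mathbb{R}_{\mathcal F}},$$ and such that the restriction of $L$ to $S^{p}IC[0,1]$ is continuous with respect to the metric on $S^{p}\overline{C}[0,1]$ $$\Psi[(s_n)_n,(t_n)_n]=\left\{\sum_{n=1}^{\infty}\|s_n-t_n\|^{p}\right\}^{1/p},$$ where $\|\cdot\|$ is the uniform norm on $\overline{C}[0,1]$.
   Context: Fuzzy numbers: $\mathbb{R}_{\mathcal F}$ is the set of all functions $u:\mathbb{R}\to[0,1]$ such that (i) there is $x_u\in\mathbb{R}$ with $u(x_u)=1$; (ii) $u(tx+(1-t)y)\ge\min\{u(x),u(y)\}$ for all $t\in[0,1]$, $x,y\in\mathbb{R}$; (iii) $u$ is upper semicontinuous on $\mathbb{R}$; (iv) the closure of $\{x\in\mathbb{R}: u(x)>0\}$ is compact. Level sets: for $0<r\le 1$, $[u]^r=\{x\in\mathbb{R}:u(x)\ge r\}$, and $[u]^0=\overline{\{x\in\mathbb{R}:u(x)>0\}}$. Each $[u]^r$ is a compact interval, written $[u]^r=[u_-(r),u_+(r)]$; this defines functions $u_-,u_+:[0,1]\to\mathbb{R}$, which belong to the space $\overline{C}[0,1]$ below. Operations: $(u\oplus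 v)(x)=\sup_{y+z=x}\min\{u(y),v(z)\}$; for $\lambda\in\mathbb{R}$, $(\lambda\odot u)(x)=u(x/\lambda)$ if $\lambda\ne0$, and $0\odot u=\widetilde 0:=\chi_{\{0\}}$. Equivalently, $[u\oplus v]^r=[u]^r+[v]^r$ and $[\lambda\odot u]^r=\lambda[u]^r$ for all $r\in[0,1]$. Metric: $D(u,v)=\sup_{r\in[0,1]}\max\{|u_-(r)-v_-(r)|,|u_+(r)-v_+(r)|\}$, and $\|u\|_{\mathcal F}=D(u,\widetilde 0)$. $l^{p}_{\mathbb{R}_{\mathcal F}}$ is the set of sequences $x=(x_n)_{n\ge1}$ in $\mathbb{R}_{\mathcal F}$ with $\sum_{n=1}^\infty\|x_n\|_{\mathcal F}^p<+\infty$, with termwise operations $\oplus,\odot$ and the metric $\rho_p(x,y)=\left\{\sum_{n=1}^\infty [D(x_n,y_n)]^p\right\}^{1/p}$. A functional $A:l^{p}_{\mathbb{R}_{\mathcal F}}\to\mathbb{R}$ is called linear if $A(x\oplus y)=A(x)+A(y)$ and $A(\lambda\odot x)=\lambda A(x)$ for all $x,y\in l^{p}_{\mathbb{R}_{\mathcal F}}$ and all $\lambda\in\mathbb{R}$. Continuous means continuous at every point. $\overline{C}[0,1]$ is the real Banach space of all bounded functions $f:[0,1]\to\mathbb{R}$ that are left continuous at each point of $(0,1]$, have a right limit at each point of $[0,1)$, and are right continuous at $0$, with the uniform norm $\|f\|=\sup\{|f(x)|:x\in[0,1]\}$. $IC[0,1]=\{f\in\overline{C}[0,1]: f\text{ is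 increasing on }[0,1]\}$, where increasing means nondecreasing. $S^{p}\overline{C}[0,1]=\{(s_n)_n: s_n\in\overline{C}[0,1],\ \sum_{n=1}^\infty\|s_n\|^p<+\infty\}$, a real vector space under termwise operations, and $S^{p}IC[0,1]=\{(s_n)_n: s_n\in IC[0,1],\ \sum_{n=1}^\infty\|s_n\|^p<+\infty\}$. $L$ is linear in the usual vector space sense. For $x=(x_n)_n\in l^{p}_{\mathbb{R}_{\mathcal F}}$, $x_-=((x_n)_-)_n$ and $x_+=((x_n)_+)_n$; these satisfy $\sum_n\|(x_n)_-\|^p<+\infty$ and $\sum_n\|(x_n)_+\|^p<+\infty$, so they lie in $S^{p}\overline{C}[0,1]$. *)

(* Defs.v *)
From HB Require Import structures.
From mathcomp Require Import all_boot all_order all_algebra.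
From mathcomp Require Import all_classical all_reals all_analysis.
From mathcomp Require Import ring lra.

Set Implicit Arguments.
Unset Strict Implicit.
Unset Printing Implicit Defensive.

Import Order.TTheory GRing.Theory Num.Theory.
Import numFieldNormedType.Exports.

Local Open Scope classical_set_scope.
Local Open Scope ring_scope.

Definition I01 (R : realType) : Type := set_type (`[0, 1]%classic : set R).
HB.instance Definition _ (R : realType) :=
  PseudoMetric.copy (I01 R) (set_type (`[0, 1]%classic : set R)).

Definition i01val {R : realType} (t : I01 R) : R := set_val t.

(* Punctured one-sided neighbourhoods, relative to [0, 1]. *)
Definition left01 {R : realType} (t : I01 R) : set_system (I01 R) :=
  within [set s | i01val s < i01val t] (nbhs t).
Definition right01 {R : realType} (t : I01 R) : set_system (I01 R) :=
  within [set s | i01val t < i01val s] (nbhs t).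

Section unit_interval.
Context {R : realType}.
Implicit Types t : I01 R.

Lemma i01_ge0 t : 0 <= i01val t.
Proof. by case: t => t tP; move: (set_mem tP); rewrite /= in_itv /= => /andP[]. Qed.

Lemma i01_le1 t : i01val t <= 1.
Proof. by case: t => t tP; move: (set_mem tP); rewrite /= in_itv /= => /andP[]. Qed.

Lemma i01_subproof (r : R) : 0 <= r <= 1 -> r \in (`[0, 1]%classic : set R).
Proof. by move=> r01; rewrite inE /= in_itv. Qed.

Definition mkI01 (r : R) (r01 : 0 <= r <= 1) : I01 R :=
  SigSub (i01_subproof r01).

Fact zero01_subproof : 0 <= (0 : R) <= 1. Proof. by rewrite lexx ler01. Qed.
Definition zero01 : I01 R := mkI01 zero01_subproof.

Lemma nbhs_i01 t (A : set (I01 R)) (e : R) : 0 < e ->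
  (forall s, `|i01val t - i01val s| < e -> A s) -> nbhs t A.
Proof.
move=> e0 H; apply/nbhs_ballP; exists e => //= s; exact: H.
Qed.

End unit_interval.

Definition uniform_norm {R : realType} (f : I01 R -> R) : R :=
  sup (range (fun t => `|f t|)).

Record in_Cbar {R : realType} (f : I01 R -> R) : Prop := InCbar {
  Cbar_bounded : exists M, forall t, `|f t| <= M ;
  Cbar_left_cont : forall t, 0 < i01val t -> f @ left01 t --> f t ;
  Cbar_right_lim : forall t, i01val t < 1 ->
    exists l : R, f @ right01 t --> l ;
  Cbar_right_cont0 : f @ right01 zero01 --> f zero01 }.

Definition Cbar_pred {R : realType} : {pred I01 R -> R} :=
  fun f => `[< in_Cbar f >].

Record Cbar (R : realType) := MkCbar {
  Cbar_fun :> I01 R -> R ;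
  Cbar_funP : Cbar_fun \in Cbar_pred }.
Arguments MkCbar {R}.

HB.instance Definition _ (R : realType) := [isSub for @Cbar_fun R].
HB.instance Definition _ (R : realType) := [Choice of Cbar R by <:].

Section Cbar_lmodule.
Context {R : realType}.

Lemma left01_filter (t : I01 R) : Filter (left01 t).
Proof. exact: within_filter. Qed.
Lemma right01_filter (t : I01 R) : Filter (right01 t).
Proof. exact: within_filter. Qed.
#[local] Existing Instance left01_filter.
#[local] Existing Instance right01_filter.

Lemma Cbar_submod_closed : submod_closed (@Cbar_pred R).
Proof.
split.
  apply/asboolP; split.
  - by exists 0 => t; rewrite normr0.
  - by move=> t _; exact: cvg_cst.
  - by move=> t _; exists 0; exact: cvg_cst.
  - exact: cvg_cst.
move=> a f g /asboolP[[M fM] fl fr f0] /asboolP[[N gN] gl gr g0].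
apply/asboolP; split.
- exists (`|a| * M + N) => t; apply: le_trans (ler_normD _ _) _.
  apply: lerD => //.
  by change (`|a * f t| <= `|a| * M); rewrite normrM ler_wpM2l.
- by move=> t t0; apply: cvgD; [apply: cvgZl_tmp; exact: fl | exact: gl].
- move=> t t1; have [k fk] := fr _ t1; have [l gl'] := gr _ t1.
  by exists (a *: k + l); apply: cvgD => //; apply: cvgZl_tmp.
- by apply: cvgD => //; apply: cvgZl_tmp.
Qed.

HB.instance Definition _ :=
  GRing.isSubmodClosed.Build R (I01 R -> R) (@Cbar_pred R) Cbar_submod_closed.

End Cbar_lmodule.

HB.instance Definition _ (R : realType) :=
  [SubChoice_isSubLmodule of Cbar R by <:].

Definition in_IC {R : realType} (f : Cbar R) : Prop :=
  forall s t : I01 R, i01val s <= i01val t -> f s <= f t.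

Definition pow_series {R : realType} (p : R) (a : nat -> R) : \bar R :=
  (\sum_(0 <= n <oo) (a n `^ p)%:E)%E.

Section pow_series_theory.
Context {R : realType} (p : R) (p1 : 1 <= p).
Implicit Types a b : nat -> R.

Let p0 : 0 <= p. Proof. exact: le_trans ler01 p1. Qed.

Lemma pow_series_ge0 a : (0 <= pow_series p a)%E.
Proof. by apply: nneseries_ge0 => n _ _; rewrite lee_fin powR_ge0. Qed.

Lemma le_pow_series a b : (forall n, 0 <= a n) -> (forall n, a n <= b n) ->
  (pow_series p b < +oo)%E -> (pow_series p a < +oo)%E.
Proof.
move=> a0 ab; apply: le_lt_trans; apply: lee_nneseries => n _.
  by rewrite lee_fin powR_ge0.
by rewrite lee_fin ge0_ler_powR// nnegrE ?(le_trans (a0 n)).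
Qed.

Lemma pow_seriesZ (c : R) a : 0 <= c -> (forall n, 0 <= a n) ->
  (pow_series p a < +oo)%E -> (pow_series p (fun n => c * a n)%R < +oo)%E.
Proof.
move=> c0 a0 aoo; rewrite /pow_series.
under eq_eseriesr do rewrite powRM// EFinM.
rewrite nneseriesZl; last by move=> n _; rewrite lee_fin powR_ge0.
by rewrite lte_mul_pinfty ?lee_fin ?powR_ge0.
Qed.

Lemma pow_seriesD a b : (forall n, 0 <= a n) -> (forall n, 0 <= b n) ->
  (pow_series p a < +oo)%E -> (pow_series p b < +oo)%E ->
  (pow_series p (fun n => a n + b n)%R < +oo)%E.
Proof.
move=> a0 b0 /(pow_seriesZ (ler0n _ 2) a0) aoo /(pow_seriesZ (ler0n _ 2) b0) boo.
apply: (@le_lt_trans _ _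
  (pow_series p (fun n => 2 * a n)%R + pow_series p (fun n => 2 * b n)%R)%E).
  rewrite /pow_series -nneseriesD; try by move=> n _ _; rewrite lee_fin powR_ge0.
  apply: lee_nneseries => n _; first by rewrite lee_fin powR_ge0.
  rewrite -EFinD lee_fin.
  have [ab|ba] := leP (a n) (b n).
    apply: (@le_trans _ _ ((2 * b n) `^ p)); last by rewrite lerDr powR_ge0.
    rewrite ge0_ler_powR ?nnegrE ?addr_ge0 ?mulr_ge0//.
    by rewrite mulrDl !mul1r lerD2r.
  apply: (@le_trans _ _ ((2 * a n) `^ p)); last by rewrite lerDl powR_ge0.
  rewrite ge0_ler_powR ?nnegrE ?addr_ge0 ?mulr_ge0//.
  by rewrite mulrDl !mul1r lerD2l ltW.
by rewrite lte_add_pinfty.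
Qed.

Lemma pow_series0 : (pow_series p (fun=> 0%R) < +oo)%E.
Proof.
rewrite /pow_series eseries0 ?ltry// => n _ _.
by rewrite powR0// gt_eqF// (lt_le_trans ltr01 p1).
Qed.

End pow_series_theory.

Section uniform_norm_theory.
Context {R : realType}.
Implicit Types f g : Cbar R.

Lemma Cbar_inP f : in_Cbar f. Proof. by apply/asboolP; exact: Cbar_funP. Qed.

Lemma normC_ub f t : `|f t| <= uniform_norm f.
Proof.
apply: sup_upper_bound; last by exists t.
split; first by exists `|f t|; exists t.
by have [[M fM] _ _ _] := Cbar_inP f; exists M => _ [s _ <-].
Qed.

Lemma normC_le f (M : R) : (forall t, `|f t| <= M) -> uniform_norm f <= M.
Proof.
move=> fM; apply: ge_sup; first by exists `|f zero01|; exists zero01.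
by move=> _ [s _ <-].
Qed.

Lemma normC_ge0 f : 0 <= uniform_norm f.
Proof. exact: le_trans (normr_ge0 (f zero01)) (normC_ub _ _). Qed.

Lemma normC0 : uniform_norm (0 : Cbar R) = 0.
Proof.
apply/eqP; rewrite eq_le normC_ge0 andbT.
by apply: normC_le => t; rewrite normr0.
Qed.

Lemma normC_linear (a : R) f g :
  uniform_norm (a *: f + g) <= `|a| * uniform_norm f + uniform_norm g.
Proof.
apply: normC_le => t; apply: le_trans (ler_normD _ _) _.
apply: lerD; last exact: normC_ub.
change (`|a * f t| <= `|a| * uniform_norm f).
by rewrite normrM ler_wpM2l ?normC_ub.
Qed.

End uniform_norm_theory.

(* The proof of [1 <= p] is a parameter only because the vector space
   structure below depends on it. *)
Definition SpC_pred {R : realType} (p : R) (p1 : 1 <= p) : {pred nat -> Cbar R} :=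
  fun s => `[< (pow_series p (fun n => uniform_norm (s n)) < +oo)%E >].

Record SpC (R : realType) (p : R) (p1 : 1 <= p) := MkSpC {
  SpC_seq :> nat -> Cbar R ;
  SpC_seqP : SpC_seq \in SpC_pred p1 }.
Arguments MkSpC {R p} p1.

HB.instance Definition _ (R : realType) (p : R) (p1 : 1 <= p) :=
  [isSub for @SpC_seq R p p1].
HB.instance Definition _ (R : realType) (p : R) (p1 : 1 <= p) :=
  [Choice of SpC p1 by <:].

Section SpC_lmodule.
Context {R : realType} (p : R) (p1 : 1 <= p).

Lemma SpC_submod_closed : submod_closed (@SpC_pred R p p1).
Proof.
split.
  apply/asboolP.
  by under [X in pow_series _ X]eq_fun do rewrite normC0; exact: pow_series0.
move=> a s t /asboolP sP /asboolP tP; apply/asboolP.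
apply: (le_pow_series p1 _ (fun n => normC_linear a (s n) (t n))).
  by move=> n; exact: normC_ge0.
apply: pow_seriesD => //.
- by move=> n; rewrite mulr_ge0 ?normC_ge0.
- by move=> n; exact: normC_ge0.
- by apply: pow_seriesZ => // n; exact: normC_ge0.
Qed.

HB.instance Definition _ :=
  GRing.isSubmodClosed.Build R (nat -> Cbar R) (@SpC_pred R p p1)
    SpC_submod_closed.

End SpC_lmodule.

HB.instance Definition _ (R : realType) (p : R) (p1 : 1 <= p) :=
  [SubChoice_isSubLmodule of SpC p1 by <:].

Definition SpIC {R : realType} (p : R) (p1 : 1 <= p) : set (SpC p1) :=
  [set s | forall n, in_IC (s n)].

Definition Psi {R : realType} (p : R) (p1 : 1 <= p) (s t : SpC p1) : R :=
  fine (pow_series p (fun n => uniform_norm (s n - t n))) `^ p^-1.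

Definition metric_continuous_on {R : realType} (T : Type) (d : T -> T -> R)
    (A : set T) (f : T -> R) : Prop :=
  forall x, A x -> forall e : R, 0 < e ->
    exists2 delta : R, 0 < delta &
      forall y, A y -> d x y < delta -> `|f x - f y| < e.

Definition upper_semicontinuous {R : realType} (u : R -> R) : Prop :=
  forall x a, u x < a -> \forall y \near x, u y < a.

Record is_fuzzy {R : realType} (u : R -> R) : Prop := IsFuzzy {
  fuzzy_range : forall x, 0 <= u x <= 1 ;
  fuzzy_normal : exists x, u x = 1 ;
  fuzzy_qconcave : forall t x y, 0 <= t <= 1 ->
    Num.min (u x) (u y) <= u (t * x + (1 - t) * y) ;
  fuzzy_usc : upper_semicontinuous u ;
  fuzzy_compact : compact (closure [set x | 0 < u x]) }.

Record fuzzy (R : realType) := MkFuzzy {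
  fuzzy_fun :> R -> R ;
  fuzzy_funP : is_fuzzy fuzzy_fun }.
Arguments MkFuzzy {R}.

Definition level {R : realType} (u : R -> R) (r : R) : set R :=
  if r == 0 then closure [set x | 0 < u x] else [set x | r <= u x].

(* [u_-] and [u_+], the end points of the compact interval [level u r]. *)
Definition lo {R : realType} (u : R -> R) (r : I01 R) : R :=
  inf (level u (i01val r)).
Definition up {R : realType} (u : R -> R) (r : I01 R) : R :=
  sup (level u (i01val r)).

Definition add_fun_fuzzy {R : realType} (u v : R -> R) (x : R) : R :=
  sup [set m | exists y z, y + z = x /\ m = Num.min (u y) (v z)].

Definition fuzzy0_fun {R : realType} (x : R) : R := (x == 0)%:R.

(* [chi_{0}] at [l = 0]; [x / 0 = 0] here, so the case split is needed. *)
Definition scale_fun_fuzzy {R : realType} (l : R) (u : R -> R) : R -> R :=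
  if l == 0 then fuzzy0_fun else fun x => u (x / l).

Definition fuzzy_dist {R : realType} (u v : fuzzy R) : R :=
  sup (range (fun r : I01 R =>
    Num.max `|lo u r - lo v r| `|up u r - up v r|)).

Section fuzzy_theory.
Context {R : realType}.
Implicit Types (u v : R -> R) (x y z : R).

Lemma fuzzy_support_bounded u : is_fuzzy u ->
  exists M, forall x, closure [set x | 0 < u x] x -> `|x| <= M.
Proof.
move=> [_ _ _ _ /compact_bounded[M [Mr MP]]]; exists (M + 1) => x ux.
by apply: MP => //; rewrite ltrDl.
Qed.

Lemma bounded_support_compact u (M : R) :
  (forall x, 0 < u x -> `|x| <= M) -> compact (closure [set x | 0 < u x]).
Proof.
move=> uM; apply: (@subclosed_compact _ _ `[(- M), M]).
- exact: closed_closure.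
- exact: segment_compact.
- have /closure_id -> : closed `[- M, M] by exact: interval_closed.
  apply: closureS => x /= /uM.
  by rewrite in_itv /= ler_norml.
Qed.

Lemma level_sub u r : 0 <= r -> level u r `<=` closure [set x | 0 < u x].
Proof.
rewrite /level le_eqVlt => /predU1P[<-|r0]; first by rewrite eqxx.
rewrite gt_eqF// => x /= rx; apply: subset_closure => /=.
exact: lt_le_trans rx.
Qed.

Lemma usc_closed u r : upper_semicontinuous u -> closed [set x | r <= u x].
Proof.
move=> uu; rewrite -openC openE => x /= /negP; rewrite -ltNge => /uu.
by rewrite /interior; apply: filterS => y /= h; apply/negP; rewrite -ltNge.
Qed.

Lemma level_compact u r : is_fuzzy u -> 0 < r -> compact [set x | r <= u x].
Proof.
move=> fu r0; apply: (subclosed_compact _ (fuzzy_compact fu)).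
  exact: usc_closed (fuzzy_usc fu).
by move=> x /= rx; apply: subset_closure; exact: lt_le_trans rx.
Qed.

Lemma fuzzy0_subproof : is_fuzzy (@fuzzy0_fun R).
Proof.
rewrite /fuzzy0_fun; split.
- by move=> x; case: eqP => _; rewrite ?lexx ?ler01.
- by exists 0; rewrite eqxx.
- move=> t x y t01; case: (eqVneq x 0) => [->|x0]; last first.
    by rewrite ge_min; apply/orP; left; rewrite ler0n.
  case: (eqVneq y 0) => [->|y0]; first by rewrite !mulr0 addr0 eqxx minxx.
  by rewrite ge_min; apply/orP; right; rewrite ler0n.
- move=> x a; case: (eqVneq x 0) => [_|x0] /= xa.
    by near=> y; apply: le_lt_trans xa; case: (y == 0).
  have : \forall y \near x, y != 0.
    apply/nbhs_ballP; exists `|x|; first by rewrite /= normr_gt0.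
    move=> y /=; rewrite /ball/=; apply: contraTneq => ->.
    by rewrite subr0 ltxx.
  by apply: filterS => y /negbTE ->.
- apply: (@bounded_support_compact _ 0) => x.
  by case: (eqVneq x 0) => [->|x0]; rewrite ?normr0// ltxx.
Unshelve. all: by end_near.
Qed.

Lemma scale_fuzzy_subproof (l : R) u :
  is_fuzzy u -> is_fuzzy (scale_fun_fuzzy l u).
Proof.
rewrite /scale_fun_fuzzy; case: (eqVneq l 0) => [_ _|l0].
  exact: fuzzy0_subproof.
move=> fu; split.
- by move=> x; exact: fuzzy_range fu _.
- have [x ux] := fuzzy_normal fu; exists (x * l).
  by rewrite mulfK.
- move=> t x y t01 /=; rewrite mulrDl -!mulrA.
  exact: (fuzzy_qconcave fu _ _ t01).
- move=> x a /(fuzzy_usc fu) xa.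
  have : (fun y => y / l) @ x --> x / l by apply: cvgMr_tmp; exact: cvg_id.
  by move=> /(_ _ xa).
- have [M uM] := fuzzy_support_bounded fu.
  apply: (@bounded_support_compact _ (M * `|l|)) => x /= ux.
  rewrite -ler_pdivrMr ?normr_gt0// -normfV -normrM; apply: uM.
  exact: subset_closure.
Qed.

Lemma add_fuzzy_has_sup u v x : is_fuzzy u -> is_fuzzy v ->
  has_sup [set m | exists y z, y + z = x /\ m = Num.min (u y) (v z)].
Proof.
move=> fu fv; split; first by exists (Num.min (u 0) (v x)), 0, x; rewrite add0r.
exists 1 => _ [y [z [_ ->]]]; rewrite ge_min.
by have /andP[_ ->] := fuzzy_range fu y.
Qed.

Lemma add_fuzzy_ge u v y z : is_fuzzy u -> is_fuzzy v ->
  Num.min (u y) (v z) <= add_fun_fuzzy u v (y + z).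
Proof.
move=> fu fv; apply: sup_upper_bound; first exact: add_fuzzy_has_sup.
by exists y, z.
Qed.

Lemma add_fuzzy_gt u v x (c : R) : is_fuzzy u -> is_fuzzy v ->
  c < add_fun_fuzzy u v x -> exists y z, [/\ y + z = x, c < u y & c < v z].
Proof.
move=> fu fv /(sup_gt (add_fuzzy_has_sup x fu fv).1)[_ [y [z [yz ->]]]].
by rewrite lt_min => /andP[? ?]; exists y, z.
Qed.

Lemma add_fuzzy_subproof u v :
  is_fuzzy u -> is_fuzzy v -> is_fuzzy (add_fun_fuzzy u v).
Proof.
move=> fu fv.
have w01 x : 0 <= add_fun_fuzzy u v x <= 1.
  apply/andP; split.
    rewrite -[x]add0r; apply: le_trans (add_fuzzy_ge 0 x fu fv).
    rewrite le_min; have /andP[-> _] := fuzzy_range fu 0.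
    by have /andP[-> _] := fuzzy_range fv x.
  apply: ge_sup; first exact: (add_fuzzy_has_sup x fu fv).1.
  move=> _ [y [z [_ ->]]]; rewrite ge_min.
  by have /andP[_ ->] := fuzzy_range fu y.
split => //.
- have [x ux] := fuzzy_normal fu; have [y vy] := fuzzy_normal fv.
  exists (x + y); apply/eqP; rewrite eq_le; have /andP[_ ->] /= := w01 (x + y).
  by apply: le_trans (add_fuzzy_ge x y fu fv); rewrite ux vy minxx.
- move=> t x x' t01; rewrite leNgt; apply/negP => wlt.
  set c := add_fun_fuzzy _ _ (_ + _) in wlt.
  move: wlt; rewrite lt_min => /andP[/(add_fuzzy_gt fu fv)[y [z [yz uy vz]]]].
  move=> /(add_fuzzy_gt fu fv)[y' [z' [yz' uy' vz']]].
  have : c < Num.min (u (t * y + (1 - t) * y')) (v (t * z + (1 - t) * z')).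
    rewrite lt_min; apply/andP; split.
      by apply: lt_le_trans (fuzzy_qconcave fu _ _ t01); rewrite lt_min uy.
    by apply: lt_le_trans (fuzzy_qconcave fv _ _ t01); rewrite lt_min vz.
  move=> /lt_le_trans /(_ (add_fuzzy_ge _ _ fu fv)).
  suff -> : t * y + (1 - t) * y' + (t * z + (1 - t) * z') =
      t * x + (1 - t) * x' by rewrite ltxx.
  by rewrite -yz -yz' !mulrDr addrACA.
- move=> x a /midf_lt[]; set b := (_ / 2) => xb ba.
  have b0 : 0 < b by have /andP[+ _] := w01 x => /le_lt_trans; apply.
  pose K := (fun q : R * R => q.1 + q.2) @`
    ([set y | b <= u y] `*` [set z | b <= v z]).
  have cK : compact K.
    apply: continuous_compact.
      by apply: continuous_subspaceT => q; exact: add_continuous.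
    by apply: compact_setX; exact: level_compact.
  have : nbhs x (~` K).
    apply: open_nbhs_nbhs; split.
      by rewrite openC; apply: compact_closed => //; exact: norm_hausdorff.
    move=> [[y z] /= [by_ bz] yz]; move: xb; rewrite ltNge -yz.
    by rewrite (le_trans _ (add_fuzzy_ge y z fu fv))// le_min by_.
  apply: filterS => x' nK; apply: le_lt_trans ba; rewrite leNgt.
  apply/negP => /(add_fuzzy_gt fu fv)[y [z [yz uy vz]]]; apply: nK.
  by exists (y, z) => //=; split; exact: ltW.
- have [M uM] := fuzzy_support_bounded fu.
  have [N vN] := fuzzy_support_bounded fv.
  apply: (@bounded_support_compact _ (M + N)) => x.
  move=> /(add_fuzzy_gt fu fv)[y [z [<- uy vz]]].
  apply: le_trans (ler_normD _ _) _; apply: lerD.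
    by apply: uM; exact: subset_closure.
  by apply: vN; exact: subset_closure.
Qed.

End fuzzy_theory.

Section end_points.
Context {R : realType}.
Implicit Types (u v : R -> R) (r s t : I01 R).

Lemma level_normal u r : is_fuzzy u -> forall x, u x = 1 ->
  level u (i01val r) x.
Proof.
move=> fu x ux; rewrite /level; case: eqP => [_|_].
  by apply: subset_closure; rewrite /= ux.
by rewrite /= ux i01_le1.
Qed.

Lemma level_neq0 u r : is_fuzzy u -> level u (i01val r) !=set0.
Proof.
by move=> fu; have [x ux] := fuzzy_normal fu; exists x; exact: level_normal.
Qed.

Lemma level_has_inf u r : is_fuzzy u -> has_inf (level u (i01val r)).
Proof.
move=> fu; split; first exact: level_neq0.
have [M uM] := fuzzy_support_bounded fu; exists (- M) => x.
by move=> /(level_sub (i01_ge0 r))/uM; rewrite ler_norml => /andP[].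
Qed.

Lemma level_has_sup u r : is_fuzzy u -> has_sup (level u (i01val r)).
Proof.
move=> fu; split; first exact: level_neq0.
have [M uM] := fuzzy_support_bounded fu; exists M => x.
by move=> /(level_sub (i01_ge0 r))/uM; rewrite ler_norml => /andP[].
Qed.

Lemma level_subset u r s : i01val r <= i01val s ->
  level u (i01val s) `<=` level u (i01val r).
Proof.
move=> rs x; rewrite {2}/level; case: eqP => [_|/eqP r0].
  exact: (level_sub (i01_ge0 s)).
have s0 : i01val s != 0.
  by rewrite gt_eqF// (lt_le_trans _ rs)// lt_def r0 i01_ge0.
by rewrite /level (negbTE s0) /=; exact: le_trans.
Qed.

Lemma lo_le u r s : is_fuzzy u -> i01val r <= i01val s -> lo u r <= lo u s.
Proof.
move=> fu rs; apply: lb_le_inf; first exact: level_neq0.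
by move=> x /(level_subset rs); apply: ge_inf; exact: (level_has_inf r fu).2.
Qed.

Lemma lo_bounded u (M : R) : is_fuzzy u -> (forall x, 0 < u x -> `|x| <= M) ->
  forall r, `|lo u r| <= M.
Proof.
move=> fu uM r.
have lM x : level u (i01val r) x -> `|x| <= M.
  move=> /(level_sub (i01_ge0 r)).
  have /closure_id clM : closed `[- M, M] by exact: interval_closed.
  have : closure [set x | 0 < u x] `<=` `[- M, M].
    rewrite clM; apply: closureS => z /= /uM.
    by rewrite in_itv /= ler_norml.
  by move=> /[apply]; rewrite /= in_itv /= ler_norml.
rewrite ler_norml; apply/andP; split.
  apply: lb_le_inf; first exact: level_neq0.
  by move=> x /lM; rewrite ler_norml => /andP[].
have [x lx] := level_neq0 r fu.
apply: (@le_trans _ _ x); first exact: ge_inf (level_has_inf r fu).2 _ lx.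
by have := lM _ lx; rewrite ler_norml => /andP[].
Qed.

Lemma fuzzy_between u x y z : is_fuzzy u -> x <= y <= z ->
  Num.min (u x) (u z) <= u y.
Proof.
move=> fu /andP[xy yz]; have [xz|zx] := ltP x z; last first.
  have -> : y = x by apply/eqP; rewrite eq_le xy (le_trans yz zx).
  by rewrite ge_min lexx.
have zx0 : 0 < z - x by rewrite subr_gt0.
have t01 : 0 <= (z - y) / (z - x) <= 1.
  rewrite divr_ge0 ?subr_ge0//= ?(ltW xz)// ler_pdivrMr// mul1r.
  by rewrite lerD2l lerN2.
have := fuzzy_qconcave fu x z t01.
suff -> : (z - y) / (z - x) * x + (1 - (z - y) / (z - x)) * z = y by [].
by field; rewrite gt_eqF.
Qed.

Lemma cvg_i01 (P : set (I01 R)) t (f : I01 R -> R) (l : R) :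
  (forall e, 0 < e -> exists2 d, 0 < d & forall s, P s ->
    `|i01val t - i01val s| < d -> `|l - f s| < e) ->
  f @ within P (nbhs t) --> l.
Proof.
move=> H; apply/cvgrPdist_lt => e /H[d d0 hd].
by apply: (nbhs_i01 d0) => s sd Ps; exact: hd.
Qed.

Lemma lo_in_Cbar u : is_fuzzy u -> in_Cbar (lo u).
Proof.
move=> fu; split.
- have [M uM] := fuzzy_support_bounded fu; exists M.
  by apply: lo_bounded => // x ux; apply: uM; exact: subset_closure.
- move=> t t0; apply: cvg_i01 => e e0.
  pose y := lo u t - e / 2.
  have yt : u y < i01val t.
    rewrite ltNge; apply/negP => tu.
    have : lo u t <= y.
      apply: ge_inf; first exact: (level_has_inf t fu).2.
      by rewrite /level gt_eqF.
    by rewrite /y; lra.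
  exists (i01val t - u y); first by rewrite subr_gt0.
  move=> s /= st; rewrite gtr0_norm ?subr_gt0// ltrD2l ltrN2 => us.
  have s0 : 0 < i01val s.
    by apply: le_lt_trans us; have /andP[] := fuzzy_range fu y.
  rewrite ger0_norm ?subr_ge0; last exact: lo_le (ltW st).
  suff : y <= lo u s by rewrite /y; lra.
  apply: lb_le_inf; first exact: level_neq0.
  move=> x; rewrite /level gt_eqF//= => sx; rewrite leNgt; apply/negP => xy.
  have [z uz] := fuzzy_normal fu.
  have yz : y <= z.
    apply: (@le_trans _ _ (lo u t)); first by rewrite /y; lra.
    by apply: ge_inf (level_normal t fu uz); exact: (level_has_inf t fu).2.
  have /(fuzzy_between fu) : x <= y <= z by rewrite ltW.
  rewrite leNgt => /negP; apply; rewrite lt_min (lt_le_trans us sx) uz.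
  exact: lt_le_trans us (i01_le1 s).
- move=> t t1.
  pose B := [set lo u s | s in [set s | i01val t < i01val s]].
  have hB : has_inf B.
    split.
      have t1' : 0 <= (1 : R) <= 1 by rewrite ler01 lexx.
      by exists (lo u (mkI01 t1')), (mkI01 t1').
    by exists (lo u t) => _ [s ts <-]; exact: lo_le (ltW ts).
  exists (inf B); apply: cvg_i01 => e e0.
  have [_ [s ts <-] se] := inf_adherent e0 hB.
  exists (i01val s - i01val t); first by rewrite subr_gt0.
  move=> r /= tr; rewrite ltr0_norm ?subr_lt0// opprB ltrD2r => rs.
  have Br : inf B <= lo u r by apply: ge_inf hB.2 _ _; exists r.
  rewrite ler0_norm ?subr_le0// opprB ltrBlDl.
  exact: le_lt_trans (lo_le fu (ltW rs)) se.
- apply: cvg_i01 => e e0.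
  have [z + ze] := inf_adherent e0 (level_has_inf zero01 fu).
  rewrite {1}/level eqxx => /(_ [set x | x < lo u zero01 + e]).
  have /[swap]/[apply] : nbhs z [set x | x < lo u zero01 + e].
    by apply: open_nbhs_nbhs; split => //; exact: open_lt.
  move=> [x [/= x0 xe]].
  exists (u x) => // s /= s0; rewrite ltr0_norm ?subr_lt0// opprB subr0 => sx.
  rewrite ler0_norm ?subr_le0; last exact: lo_le (ltW s0).
  rewrite opprB ltrBlDl; apply: le_lt_trans xe.
  apply: ge_inf; first exact: (level_has_inf s fu).2.
  by rewrite /level gt_eqF//= ltW.
Qed.

Lemma closure_opp (P : R -> Prop) y :
  closure [set x | P (- x)] y -> closure [set x | P x] (- y).
Proof.
move=> H B nB; have : nbhs y (-%R @^-1` B) by exact: (@oppr_continuous R R^o y).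
by move=> /H[x [Px Bx]]; exists (- x).
Qed.

Lemma level_opp u (r : R) :
  level (scale_fun_fuzzy (-1) u) r = -%R @` level u r.
Proof.
have e : scale_fun_fuzzy (-1) u = u \o -%R.
  by apply/funext => x; rewrite /scale_fun_fuzzy oppr_eq0 oner_eq0 invrN1 mulrN1.
rewrite e /level; case: eqP => _; apply/seteqP; split => x.
- move=> /(@closure_opp (fun x => 0 < u x)) ux.
  by exists (- x); rewrite ?opprK.
- move=> [y uy <-]; apply: (@closure_opp (fun x => 0 < u (- x))).
  by under eq_set do rewrite opprK.
- by move=> ux; exists (- x); rewrite ?opprK.
- by move=> [y uy <-] /=; rewrite opprK.
Qed.

Lemma up_opp u r : up u r = - lo (scale_fun_fuzzy (-1) u) r.
Proof.
rewrite /lo /inf level_opp opprK image_comp (_ : -%R \o -%R = id) ?image_id//.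
by apply/funext => x /=; rewrite opprK.
Qed.

Lemma up_in_Cbar u : is_fuzzy u -> in_Cbar (up u).
Proof.
move=> /(scale_fuzzy_subproof (-1))/lo_in_Cbar fu.
have [C0 Clin] := @Cbar_submod_closed R.
have -> : up u = (-1) *: lo (scale_fun_fuzzy (-1) u) + 0.
  by apply/funext => r; rewrite addr0 up_opp scaleN1r.
by apply/asboolP; apply: Clin => //; exact/asboolP.
Qed.

End end_points.

Definition loC {R : realType} (u : fuzzy R) : Cbar R :=
  MkCbar (lo u) (asboolT (lo_in_Cbar (fuzzy_funP u))).
Definition upC {R : realType} (u : fuzzy R) : Cbar R :=
  MkCbar (up u) (asboolT (up_in_Cbar (fuzzy_funP u))).

Definition fuzzy0 {R : realType} : fuzzy R := MkFuzzy _ fuzzy0_subproof.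
Definition fuzzy_add {R : realType} (u v : fuzzy R) : fuzzy R :=
  MkFuzzy _ (add_fuzzy_subproof (fuzzy_funP u) (fuzzy_funP v)).
Definition fuzzy_scale {R : realType} (l : R) (u : fuzzy R) : fuzzy R :=
  MkFuzzy _ (scale_fuzzy_subproof l (fuzzy_funP u)).

Definition fuzzy_norm {R : realType} (u : fuzzy R) : R := fuzzy_dist u fuzzy0.

Section fuzzy_norm_theory.
Context {R : realType}.
Implicit Types (u v : fuzzy R) (r : I01 R).

Lemma fuzzy_dist_has_sup u v : has_sup (range (fun r : I01 R =>
  Num.max `|lo u r - lo v r| `|up u r - up v r|)).
Proof.
split; first by eexists; exists zero01.
exists (Num.max (uniform_norm (loC u - loC v)) (uniform_norm (upC u - upC v))).
move=> _ [r _ <-]; rewrite ge_max !le_max.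
by rewrite (normC_ub (loC u - loC v) r) (normC_ub (upC u - upC v) r) orbT.
Qed.

Lemma fuzzy_dist_lo u v : uniform_norm (loC u - loC v) <= fuzzy_dist u v.
Proof.
apply: normC_le => r.
have := sup_upper_bound (fuzzy_dist_has_sup u v) (imageT _ r).
by apply: le_trans; rewrite le_max lexx.
Qed.

Lemma fuzzy_dist_up u v : uniform_norm (upC u - upC v) <= fuzzy_dist u v.
Proof.
apply: normC_le => r.
have := sup_upper_bound (fuzzy_dist_has_sup u v) (imageT _ r).
by apply: le_trans; rewrite le_max lexx orbT.
Qed.

Lemma fuzzy_dist_le u v (M : R) :
  (forall r, `|lo u r - lo v r| <= M) -> (forall r, `|up u r - up v r| <= M) ->
  fuzzy_dist u v <= M.
Proof.
move=> loM upM; apply: ge_sup; first exact: (fuzzy_dist_has_sup u v).1.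
by move=> _ [r _ <-]; rewrite ge_max loM upM.
Qed.

Lemma fuzzy_dist_ge0 u v : 0 <= fuzzy_dist u v.
Proof. exact: le_trans (normC_ge0 _) (fuzzy_dist_lo u v). Qed.

Lemma lo_fuzzy0 r : lo (fuzzy0 : fuzzy R) r = 0.
Proof.
apply/eqP; rewrite -normr_le0; apply: lo_bounded; first exact: fuzzy_funP.
move=> x /=; rewrite /fuzzy0_fun; case: eqP => [->|_]; last by rewrite ltxx.
by rewrite normr0.
Qed.

Lemma up_bounded u (M : R) : (forall x, 0 < u x -> `|x| <= M) ->
  forall r, `|up u r| <= M.
Proof.
move=> uM r; rewrite up_opp normrN.
apply: lo_bounded; first exact: scale_fuzzy_subproof (fuzzy_funP u).
move=> x; rewrite /scale_fun_fuzzy oppr_eq0 oner_eq0 invrN1 mulrN1 => /uM.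
by rewrite normrN.
Qed.

Lemma up_fuzzy0 r : up (fuzzy0 : fuzzy R) r = 0.
Proof.
apply/eqP; rewrite -normr_le0; apply: up_bounded.
move=> x /=; rewrite /fuzzy0_fun; case: eqP => [->|_]; last by rewrite ltxx.
by rewrite normr0.
Qed.

Lemma fuzzy_norm_le u (M : R) :
  (forall x, 0 < u x -> `|x| <= M) -> fuzzy_norm u <= M.
Proof.
move=> uM; apply: fuzzy_dist_le => r.
  by rewrite lo_fuzzy0 subr0; exact: lo_bounded (fuzzy_funP u) uM r.
by rewrite up_fuzzy0 subr0; exact: up_bounded.
Qed.

Lemma norm_loC u : uniform_norm (loC u) <= fuzzy_norm u.
Proof.
apply: le_trans (fuzzy_dist_lo u fuzzy0); apply: normC_le => r.
apply: le_trans (normC_ub (loC u - loC fuzzy0) r).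
change (`|lo u r| <= `|lo u r - lo fuzzy0 r|).
by rewrite lo_fuzzy0 subr0.
Qed.

Lemma norm_upC u : uniform_norm (upC u) <= fuzzy_norm u.
Proof.
apply: le_trans (fuzzy_dist_up u fuzzy0); apply: normC_le => r.
apply: le_trans (normC_ub (upC u - upC fuzzy0) r).
change (`|up u r| <= `|up u r - up fuzzy0 r|).
by rewrite up_fuzzy0 subr0.
Qed.

Lemma fuzzy_norm_ge0 u : 0 <= fuzzy_norm u.
Proof. exact: fuzzy_dist_ge0. Qed.

Lemma fuzzy_norm_ub u x : 0 < u x -> `|x| <= fuzzy_norm u.
Proof.
move=> ux; have lx : level u (i01val (zero01 : I01 R)) x.
  by rewrite /level eqxx; exact: subset_closure.
rewrite ler_norml; apply/andP; split.
  have : lo u zero01 <= x by apply: ge_inf (level_has_inf _ (fuzzy_funP u)).2 _ _.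
  apply: le_trans; have := le_trans (normC_ub (loC u) zero01) (norm_loC u).
  by rewrite ler_norml => /andP[].
have : x <= up u zero01.
  by apply: sup_upper_bound lx; exact: (level_has_sup _ (fuzzy_funP u)).
move=> /le_trans; apply.
have := le_trans (normC_ub (upC u) zero01) (norm_upC u).
by rewrite ler_norml => /andP[].
Qed.

Lemma fuzzy_norm_add u v :
  fuzzy_norm (fuzzy_add u v) <= fuzzy_norm u + fuzzy_norm v.
Proof.
apply: fuzzy_norm_le => x.
move=> /(add_fuzzy_gt (fuzzy_funP u) (fuzzy_funP v))[y [z [<- uy vz]]].
apply: le_trans (ler_normD _ _) _.
by apply: lerD; exact: fuzzy_norm_ub.
Qed.

Lemma fuzzy_norm_scale (l : R) u :
  fuzzy_norm (fuzzy_scale l u) <= `|l| * fuzzy_norm u.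
Proof.
apply: fuzzy_norm_le => x /=; rewrite /scale_fun_fuzzy.
case: (eqVneq l 0) => [->|l0].
  rewrite /fuzzy0_fun; case: eqP => [->|_]; last by rewrite ltxx.
  by rewrite !normr0 mul0r.
move=> /fuzzy_norm_ub; rewrite normrM normfV ler_pdivrMr ?normr_gt0//.
by rewrite mulrC.
Qed.

Lemma fuzzy_dist_le_norm u v :
  fuzzy_dist u v <= fuzzy_norm u + fuzzy_norm v.
Proof.
apply: fuzzy_dist_le => r; apply: le_trans (ler_normB _ _) _; apply: lerD.
- exact: le_trans (normC_ub (loC u) r) (norm_loC u).
- exact: le_trans (normC_ub (loC v) r) (norm_loC v).
- exact: le_trans (normC_ub (upC u) r) (norm_upC u).
- exact: le_trans (normC_ub (upC v) r) (norm_upC v).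
Qed.

End fuzzy_norm_theory.

Record lpF (R : realType) (p : R) (p1 : 1 <= p) := MkLpF {
  lpF_seq :> nat -> fuzzy R ;
  lpF_seqP : (pow_series p (fun n => fuzzy_norm (lpF_seq n)) < +oo)%E }.
Arguments MkLpF {R p} p1.

Section lpF_operations.
Context {R : realType} (p : R) (p1 : 1 <= p).
Implicit Types x y : lpF p1.

Lemma lpF_add_subproof x y :
  (pow_series p (fun n => fuzzy_norm (fuzzy_add (x n) (y n))) < +oo)%E.
Proof.
apply: (le_pow_series p1 _ (fun n => fuzzy_norm_add (x n) (y n))).
  by move=> n; exact: fuzzy_norm_ge0.
by apply: pow_seriesD (lpF_seqP x) (lpF_seqP y) => // n; exact: fuzzy_norm_ge0.
Qed.

Lemma lpF_scale_subproof (l : R) x :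
  (pow_series p (fun n => fuzzy_norm (fuzzy_scale l (x n))) < +oo)%E.
Proof.
apply: (le_pow_series p1 _ (fun n => fuzzy_norm_scale l (x n))).
  by move=> n; exact: fuzzy_norm_ge0.
by apply: pow_seriesZ (lpF_seqP x) => // n; exact: fuzzy_norm_ge0.
Qed.

Definition lpF_add x y : lpF p1 := MkLpF p1 _ (lpF_add_subproof x y).
Definition lpF_scale (l : R) x : lpF p1 := MkLpF p1 _ (lpF_scale_subproof l x).

Lemma lpF_minus_subproof x : (fun n => loC (x n)) \in SpC_pred p1.
Proof.
apply/asboolP; apply: (le_pow_series p1 _ (fun n => norm_loC (x n))).
  by move=> n; exact: normC_ge0.
exact: lpF_seqP.
Qed.

Lemma lpF_plus_subproof x : (fun n => upC (x n)) \in SpC_pred p1.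
Proof.
apply/asboolP; apply: (le_pow_series p1 _ (fun n => norm_upC (x n))).
  by move=> n; exact: normC_ge0.
exact: lpF_seqP.
Qed.

Definition lpF_minus x : SpC p1 := MkSpC p1 _ (lpF_minus_subproof x).
Definition lpF_plus x : SpC p1 := MkSpC p1 _ (lpF_plus_subproof x).

Definition rho x y : R :=
  fine (pow_series p (fun n => fuzzy_dist (x n) (y n))) `^ p^-1.

Definition lpF_linear (A : lpF p1 -> R) : Prop :=
  (forall x y, A (lpF_add x y) = A x + A y) /\
  (forall (l : R) x, A (lpF_scale l x) = l * A x).

(* The series in [rho] and [Psi] converge, so [fine] loses nothing. *)
Lemma rho_fin x y :
  pow_series p (fun n => fuzzy_dist (x n) (y n)) \is a fin_num.
Proof.
rewrite ge0_fin_numE ?pow_series_ge0//.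
apply: (le_pow_series p1 _ (fun n => fuzzy_dist_le_norm (x n) (y n))).
  by move=> n; exact: fuzzy_dist_ge0.
by apply: pow_seriesD (lpF_seqP x) (lpF_seqP y) => // n; exact: fuzzy_norm_ge0.
Qed.

Lemma Psi_fin (s t : SpC p1) :
  pow_series p (fun n => uniform_norm (s n - t n)) \is a fin_num.
Proof.
rewrite ge0_fin_numE ?pow_series_ge0//.
by have /asboolP := SpC_seqP (s - t).
Qed.

End lpF_operations.

(* Main.v *)
Require Import Defs.
From HB Require Import structures.
From mathcomp Require Import all_boot all_order all_algebra.
From mathcomp Require Import all_classical all_reals all_analysis.
From mathcomp Require Import ring lra.

                                                                           
                                                                           
                                                                        
                                                                           
                                                                              
                                                                              
                                                                           
                                                                              
                                                                              
                                                                     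

Set Implicit Arguments.
Unset Strict Implicit.
Unset Printing Implicit Defensive.

Import Order.TTheory GRing.Theory Num.Theory.
Import numFieldNormedType.Exports.
Local Open Scope classical_set_scope.
Local Open Scope ring_scope.

(** Write $\sigma(x) = x_- + x_+$ ([end_points_sum]). A negative scalar exchanges the two end
    points, and their sum does not notice the exchange, so $\sigma$ is additive and homogeneous for
    all real scalars ([end_points_sumD], [end_points_sumZ]).

    From $x^*$ to $L$: if $\sigma(z) = 0$, the level sets of $z$ are symmetric about $0$, hence
    $(-1) \odot z = z$ and $x^*(z) = -x^*(z) = 0$ ([lpF_linear_eq0]). So $\sigma(x) \mapsto x^*(x)$
    is a well defined linear functional on the range of $\sigma$, and Zorn's lemma extends it to the
    whole space ([linear_extension]). The extension itself carries no continuity; on increasing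
    sequences this comes from an explicit section of $\sigma$: an increasing $f$ equals $u_- + u_+$
    for the fuzzy number $u$ with levels $[f(t) - f(1)/2, f(1)/2]$, and the choice is Lipschitz in
    $f$ ([SpIC_sum_representative], [rho_le_Psi]).

    From $L$ to $x^*$: linearity is that of $\sigma$. For continuity, $x_-$ is increasing, and so is
    $-x_+ = ((-1) \odot x)_-$; thus $x^*(x) = L(x_-) - L(-x_+)$ evaluates $L$ only where it is
    continuous. *)

(** * Algebraic extension of linear functionals by Zorn's lemma *)

Section linear_relation.
Context {K : fieldType} {V : lmodType K}.
Implicit Types (G : set (V * K)) (v w : V) (a b c : K).

(** A partial linear functional is handled through its graph, a subspace of $V \times K$ once
    nonempty. Graphs are ordered by inclusion and need no separate record of the domain. *)
Definition linear_relation G := forall a v b w c,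
  G (v, b) -> G (w, c) -> G (a *: v + w, a * b + c).

Definition functional_relation G := forall c, G (0, c) -> c = 0.

Lemma linear_relation0 G : linear_relation G -> G !=set0 -> G (0, 0).
Proof.
move=> linG [[v b] Gv]; have := linG (-1) _ _ _ _ Gv Gv.
by rewrite scaleN1r mulN1r !addNr.
Qed.

Lemma functional_relation_eq G v b c : linear_relation G ->
  functional_relation G -> G (v, b) -> G (v, c) -> b = c.
Proof.
move=> linG funG Gb Gc; have := linG (-1) _ _ _ _ Gb Gc.
rewrite scaleN1r mulN1r addNr => /funG/eqP.
by rewrite addrC subr_eq0 => /eqP.
Qed.

(** If $v$ were outside the domain, the functional could be extended to the line through $v$ by
    giving $v$ the value $0$. *)
Lemma maximal_linear_relation_total G : linear_relation G ->
    functional_relation G -> G !=set0 ->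
    (forall H, G `<=` H -> linear_relation H -> functional_relation H ->
      H `<=` G) ->
  forall v, exists b, G (v, b).
Proof.
move=> linG funG G0 maxG v; apply: contrapT => nGv.
have G00 := linear_relation0 linG G0.
pose H := [set x : V * K | exists a u, x.1 = u + a *: v /\ G (u, x.2)].
have linH : linear_relation H.
  move=> a _ b _ c [a1 [u1 [/= -> Gu1]]] [a2 [u2 [/= -> Gu2]]].
  exists (a * a1 + a2), (a *: u1 + u2); split; last exact: linG.
  by rewrite /= scalerDr scalerA addrACA -scalerDl.
have funH : functional_relation H.
  move=> c [a [u [/= /esym/eqP]]]; rewrite addr_eq0 => /eqP -> Gu.
  have [a0|a0] := eqVneq a 0.
    by apply: funG; move: Gu; rewrite a0 scale0r oppr0.
  (* Here $-a v$ lies in the domain with $a \ne 0$; dividing by $-a$ puts $v$ there too. *)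
  exfalso; apply: nGv; exists (- a^-1 * c + 0).
  have := linG (- a^-1) _ _ _ _ Gu G00.
  by rewrite scalerN scaleNr opprK scalerA mulVf// scale1r addr0.
apply: nGv; exists 0; apply: (maxG H) => //.
  by move=> [u c] Gu; exists 0, u; rewrite /= scale0r addr0.
by exists 1, 0; rewrite /= add0r scale1r.
Qed.

Lemma linear_extension G : linear_relation G -> functional_relation G ->
  G !=set0 -> exists L : {scalar V}, forall v b, G (v, b) -> L v = b.
Proof.
move=> linG funG G0.
                                                                    
(* The guard [H !=set0] makes [P] hold for the empty set, which is the union of the empty chain. A
   maximal [H] is nonempty all the same, because [G] would lie strictly above the empty set. *)
pose P H := [/\ linear_relation H, functional_relation H &
  H !=set0 -> G `<=` H].
have [F FP totF|H [[linH funH GH] maxH]] := @Zorn_bigcup (V * K)%type P.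
  split.
  - move=> a v b w c [X FX Xv] [Y FY Yw].
    have [XY|YX] := totF _ _ FX FY.
      by exists Y => //; have [+ _ _] := FP _ FY; apply => //; exact: XY.
    by exists X => //; have [+ _ _] := FP _ FX; apply => //; exact: YX.
  - by move=> c [X FX Xc]; have [_ + _] := FP _ FX; exact.
  - move=> [x [X FX Xx]] y Gy; exists X => //.
    by have [_ _ +] := FP _ FX; apply => //; exists x.
have H0 : H !=set0.
  apply: contrapT => H0; apply: (maxH G); last by split=> // _ x.
  rewrite /proper; split=> [x Hx|GH']; first by exfalso; apply: H0; exists x.
  by have [x /GH' Hx] := G0; apply: H0; exists x.
have /choice[L HL] : forall v, exists b, H (v, b).
  apply: (maximal_linear_relation_total linH funH H0) => H' HH' linH' funH'.
  apply: contrapT => H'H; apply: (maxH H'); first by split.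
  by split=> // _; apply: subset_trans HH'; exact: GH.
have linL : scalar L.
  move=> a v w; apply: (functional_relation_eq linH funH (HL _)).
  exact: linH.
pose L' : {scalar V} := HB.pack L (GRing.isLinear.Build _ _ _ _ _ linL).
exists L' => v b Gvb.
exact: functional_relation_eq linH funH (HL v) (GH H0 _ Gvb).
Qed.

End linear_relation.

(** * One-sided limits on the unit interval *)

Section unit_interval_limits.
Context {R : realType}.
Implicit Types (t s : I01 R) (f g : Cbar R).

Lemma left01_proper t : 0 < i01val t -> ProperFilter (left01 t).
Proof.
move=> t0; split; last exact: left01_filter.
move=> /nbhs_ballP[e /= e0] /(_ _ _)/= h.
pose d := Num.min (i01val t) e / 2.
have d0 : 0 < d by rewrite divr_gt0// lt_min t0.
have /andP[dt de] : (d <= i01val t) && (d < e).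
  have : 0 < Num.min (i01val t) e by rewrite lt_min t0.
  have : Num.min (i01val t) e <= i01val t by rewrite ge_min lexx.
  have : Num.min (i01val t) e <= e by rewrite ge_min lexx orbT.
  by rewrite /d; lra.
have s01 : 0 <= i01val t - d <= 1 by have := i01_le1 t; lra.
apply: (h (mkI01 s01)); last by rewrite /= ltrBlDr ltrDl.
change (`|i01val t - (i01val t - d)| < e).
by rewrite opprB addrCA subrr addr0 gtr0_norm.
Qed.

Lemma right01_proper : ProperFilter (right01 (@zero01 R)).
Proof.
split; last exact: right01_filter.
move=> /nbhs_ballP[e /= e0] /(_ _ _)/= h.
pose d := Num.min 1 e / 2.
have d0 : 0 < d by rewrite divr_gt0// lt_min ltr01.
have /andP[d1 de] : (d <= 1) && (d < e).
  have : 0 < Num.min 1 e by rewrite lt_min ltr01.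
  have : Num.min 1 e <= 1 by rewrite ge_min lexx.
  have : Num.min 1 e <= e by rewrite ge_min lexx orbT.
  by rewrite /d; lra.
have s01 : 0 <= d <= 1 by rewrite ltW.
apply: (h (mkI01 s01)) => //.
by change (`|0 - d| < e); rewrite sub0r normrN gtr0_norm.
Qed.

Lemma Cbar_left_le f t (x : R) : 0 < i01val t ->
  (forall s, i01val s < i01val t -> f s <= x) -> f t <= x.
Proof.
move=> t0 fx; have := left01_proper t0 => ?.
apply: cvgr_to_le (Cbar_left_cont (Cbar_inP f) t0) _.
by apply: filterS (near_withinT _ _) => // s; exact: fx.
Qed.

Lemma Cbar_eq f g : f =1 g -> f = g.
Proof. by move=> fg; apply: val_inj; exact/funext. Qed.

(** The value at $0$ is the right limit there. This spares later comparisons the level $0$, which is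
    defined by a closure. *)
Lemma Cbar_ext f g : (forall t, 0 < i01val t -> f t = g t) -> f = g.
Proof.
move=> fg; apply: Cbar_eq => t.
have [/fg//|t0] := ltP 0 (i01val t).
have -> : t = zero01.
  by apply: val_inj; apply/eqP; rewrite eq_le t0 i01_ge0.
have := right01_proper => ?.
apply: (cvg_unique (@norm_hausdorff _ R) (Cbar_right_cont0 (Cbar_inP f))).
apply: cvg_trans (Cbar_right_cont0 (Cbar_inP g)).
apply: near_eq_cvg; apply: filterS (near_withinT _ _) => // s s0.
by rewrite fg.
Qed.

End unit_interval_limits.

(** * Level sets as intervals, and end points under the operations *)

Section fuzzy_end_points.
Context {R : realType}.
Implicit Types (t s : I01 R) (f g : Cbar R) (u v : fuzzy R) (x : R).

Lemma up_ge_level u t x : 0 < i01val t -> i01val t <= u x -> x <= up u t.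
Proof.
move=> t0 tx; apply: sup_upper_bound; first exact: level_has_sup (fuzzy_funP u).
by rewrite /level gt_eqF.
Qed.

Lemma lo_le_level u t x : 0 < i01val t -> i01val t <= u x -> lo u t <= x.
Proof.
move=> t0 tx; apply: ge_inf; first exact: (level_has_inf _ (fuzzy_funP u)).2.
by rewrite /level gt_eqF.
Qed.

(** The infimum is attained: otherwise upper semicontinuity would keep $u$ below $t$ near it, where
    there are points of the level set. *)
Lemma level_lo u t : 0 < i01val t -> i01val t <= u (lo u t).
Proof.
move=> t0; rewrite leNgt; apply/negP => /(fuzzy_usc (fuzzy_funP u)).
move=> /nbhs_ballP[e /= e0 he].
have := inf_adherent e0 (level_has_inf t (fuzzy_funP u)).
move=> [x]; rewrite {1}/level gt_eqF//= => tx xe.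
have lx := lo_le_level t0 tx.
suff /he/= : ball (lo u t) e x by rewrite ltNge tx.
rewrite /ball/= distrC ger0_norm ?subr_ge0//.
by rewrite ltrBlDl.
Qed.

Lemma level_up u t : 0 < i01val t -> i01val t <= u (up u t).
Proof.
move=> t0; rewrite up_opp.
have := level_lo (fuzzy_scale (-1) u) t0.
by rewrite /= {1}/scale_fun_fuzzy oppr_eq0 oner_eq0 invrN1 mulrN1.
Qed.

Lemma fuzzy_levelP u t x : 0 < i01val t ->
  i01val t <= u x <-> lo u t <= x <= up u t.
Proof.
move=> t0; split => [tx|lxu]; first by rewrite lo_le_level// up_ge_level.
apply: le_trans (fuzzy_between (fuzzy_funP u) lxu).
by rewrite le_min level_lo// level_up.
Qed.

Lemma lo_le_up u t : 0 < i01val t -> lo u t <= up u t.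
Proof. by move=> t0; apply: lo_le_level => //; exact: level_up. Qed.

(** Nonempty closed intervals determine their end points, so the positive levels identify $u_-$ and
    $u_+$; level $0$ follows by [Cbar_ext]. *)
Lemma end_pointsP u f g :
  (forall t, 0 < i01val t -> f t <= g t) ->
  (forall t x, 0 < i01val t -> i01val t <= u x <-> f t <= x <= g t) ->
  loC u = f /\ upC u = g.
Proof.
move=> fg ufg; have uE t x : 0 < i01val t ->
    lo u t <= x <= up u t <-> f t <= x <= g t.
  by move=> t0; rewrite -fuzzy_levelP//; exact: ufg.
split; apply: Cbar_ext => t t0; apply/eqP; rewrite eq_le; apply/andP; split.
- by have /(uE t _ t0)/andP[] : f t <= f t <= g t by rewrite lexx fg.
- have : lo u t <= lo u t <= up u t by rewrite lexx lo_le_up.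
  by case/(uE t _ t0)/andP.
- have : lo u t <= up u t <= up u t by rewrite lexx lo_le_up.
  by case/(uE t _ t0)/andP.
- by have /(uE t _ t0)/andP[] : f t <= g t <= g t by rewrite lexx fg.
Qed.

Lemma fuzzy_ext u v : loC u = loC v -> upC u = upC v -> u = v.
Proof.
move=> luv uuv; have levE t x : 0 < i01val t ->
    i01val t <= u x <-> i01val t <= v x.
  have lE : lo u t = lo v t := congr1 (fun w : Cbar R => w t) luv.
  have uE : up u t = up v t := congr1 (fun w : Cbar R => w t) uuv.
  by move=> t0; rewrite !fuzzy_levelP// lE uE.
suff uv : u =1 v.
  move: {luv uuv levE} uv; case: u => u fu; case: v => v fv /= /funext uv.
  by move: fu fv; rewrite uv => fu fv; congr MkFuzzy; exact: Prop_irrelevance.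
suff le (w w' : fuzzy R) :
    (forall t x, 0 < i01val t -> i01val t <= w x -> i01val t <= w' x) ->
    forall x, w x <= w' x.
  move=> x; apply/eqP; rewrite eq_le.
  by apply/andP; split; apply: le => t y t0; apply levE.
move: w w' => w w' ww' x; have [w0|w0] := leP (w x) 0.
  by apply: le_trans w0 _; have /andP[] := fuzzy_range (fuzzy_funP w') x.
(* The value [w x] is itself used as the level. *)
exact: (ww' (mkI01 (fuzzy_range (fuzzy_funP w) x))).
Qed.

(** A point of $[u]^t + [v]^t$ is split explicitly. Conversely, the supremum defining $u \oplus v$
    is not shown to be attained: the point is split at each level $s < t$, and left continuity
    carries the bounds to $t$. *)
Lemma end_points_add u v :
  loC (fuzzy_add u v) = loC u + loC v /\ upC (fuzzy_add u v) = upC u + upC v.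
Proof.
have [fu fv] := (fuzzy_funP u, fuzzy_funP v).
apply: end_pointsP => [t t0|t x t0]; first by apply: lerD; exact: lo_le_up.
split=> [tx|/andP[lx xu]]; last first.
  (* The largest first summand allowed by $y \le u_+(t)$ and $x - y \ge v_-(t)$; the other two
     bounds follow from those on $x$. *)
  pose y := Num.min (up u t) (x - lo v t).
  have -> : x = y + (x - y) by rewrite addrC subrK.
  apply: le_trans (add_fuzzy_ge _ _ fu fv).
  have {}lx : lo u t + lo v t <= x := lx.
  have {}xu : x <= up u t + up v t := xu.
  have luu := lo_le_up u t0; have luv := lo_le_up v t0.
  rewrite le_min; apply/andP; split; apply/fuzzy_levelP => //; rewrite /y;
    by case: (leP (up u t) (x - lo v t)); lra.
have add_lt s : i01val s < i01val t ->
    exists y z, [/\ y + z = x, lo u s <= y <= up u s & lo v s <= z <= up v s].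
  move=> st; have := add_fuzzy_gt fu fv (lt_le_trans st tx).
  move=> [y [z [yz sy sz]]]; exists y, z.
  have lev w a : i01val s < (w : fuzzy R) a -> level w (i01val s) a.
    rewrite /level; case: eqP => [-> wa|_ /ltW//]; exact: subset_closure.
  split=> //; apply/andP; split.
  - by apply: ge_inf (lev _ _ sy); exact: (level_has_inf _ fu).2.
  - by apply: sup_upper_bound (lev _ _ sy); exact: level_has_sup.
  - by apply: ge_inf (lev _ _ sz); exact: (level_has_inf _ fv).2.
  - by apply: sup_upper_bound (lev _ _ sz); exact: level_has_sup.
apply/andP; split.
  apply: Cbar_left_le => // s /add_lt[y [z [<- /andP[uy _] /andP[vz _]]]].
  exact: lerD.
rewrite -lerN2; apply: (@Cbar_left_le _ (- (upC u + upC v))) => // s.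
move=> /add_lt[y [z [<- /andP[_ yu] /andP[_ zv]]]].
change (- (up u s + up v s) <= - (y + z)).
by rewrite lerN2 lerD.
Qed.

Lemma end_points_scale_gt0 (a : R) u : 0 < a ->
  loC (fuzzy_scale a u) = a *: loC u /\ upC (fuzzy_scale a u) = a *: upC u.
Proof.
move=> a0; apply: end_pointsP => [t t0|t x t0].
  by change (a * lo u t <= a * up u t); rewrite ler_pM2l// lo_le_up.
change (i01val t <= scale_fun_fuzzy a u x <-> a * lo u t <= x <= a * up u t).
rewrite /scale_fun_fuzzy gt_eqF// fuzzy_levelP// ler_pdivlMr// ler_pdivrMr//.
by rewrite !(mulrC a).
Qed.

Lemma end_points_scale_lt0 (a : R) u : a < 0 ->
  loC (fuzzy_scale a u) = a *: upC u /\ upC (fuzzy_scale a u) = a *: loC u.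
Proof.
move=> a0; apply: end_pointsP => [t t0|t x t0].
  by change (a * up u t <= a * lo u t); rewrite ler_nM2l// lo_le_up.
change (i01val t <= scale_fun_fuzzy a u x <-> a * up u t <= x <= a * lo u t).
rewrite /scale_fun_fuzzy lt_eqF// fuzzy_levelP// ler_ndivlMr// ler_ndivrMr//.
by rewrite !(mulrC a) andbC.
Qed.

Lemma loC0 : loC fuzzy0 = 0 :> Cbar R.
Proof. by apply: Cbar_eq => t; exact: lo_fuzzy0. Qed.

Lemma upC0 : upC fuzzy0 = 0 :> Cbar R.
Proof. by apply: Cbar_eq => t; exact: up_fuzzy0. Qed.

Lemma fuzzy_scale0 u : fuzzy_scale 0 u = fuzzy0.
Proof.
suff E : scale_fun_fuzzy 0 u = fuzzy0_fun.
  rewrite /fuzzy_scale /fuzzy0; move: (scale_fuzzy_subproof _ _).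
  by rewrite E => ?; congr MkFuzzy; exact: Prop_irrelevance.
by rewrite /scale_fun_fuzzy eqxx.
Qed.

(** Neither end point alone is homogeneous for negative scalars; the sum is, since the exchange only
    permutes its terms. *)
Lemma end_points_sum_scale (a : R) u :
  loC (fuzzy_scale a u) + upC (fuzzy_scale a u) = a *: (loC u + upC u).
Proof.
have [a0|a0|->] := ltgtP a 0.
- by have [-> ->] := end_points_scale_lt0 u a0; rewrite -scalerDr addrC.
- by have [-> ->] := end_points_scale_gt0 u a0; rewrite -scalerDr.
- by rewrite fuzzy_scale0 loC0 upC0 addr0 scale0r.
Qed.

End fuzzy_end_points.

(** * Fuzzy numbers with prescribed end points *)

Section fuzzy_of_end_points.
Context {R : realType}.
Implicit Types (t s : I01 R) (u v : fuzzy R) (x : R).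

Fact one01_subproof : 0 <= (1 : R) <= 1. Proof. by rewrite ler01 lexx. Qed.
Definition one01 : I01 R := mkI01 one01_subproof.

Section construction.
Variables f g : Cbar R.
Hypothesis f_nd : forall s t, i01val s <= i01val t -> f s <= f t.
Hypothesis g_ni : forall s t, i01val s <= i01val t -> g t <= g s.
Hypothesis fg : forall t, f t <= g t.

                                                              
(** The membership function of the nested family $[f(t), g(t)]$. Outside all the intervals the set
    is empty and [sup] takes its default value $0$, as it should. *)
Definition fun_of_end_points x : R :=
  sup (i01val @` [set t | f t <= x <= g t]).

Let has_ubound_levels x :
  has_ubound (i01val @` [set t | f t <= x <= g t]).
Proof. by exists 1 => _ [t _ <-]; exact: i01_le1. Qed.

Lemma fun_of_end_points_ge t x : f t <= x <= g t ->
  i01val t <= fun_of_end_points x.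
Proof. by move=> tx; apply: ub_le_sup => //; exists t. Qed.

Lemma fun_of_end_points_ge0 x : 0 <= fun_of_end_points x.
Proof.
rewrite /fun_of_end_points; have [->|/set0P[t tx]] :=
    eqVneq (i01val @` [set t | f t <= x <= g t]) set0.
  by rewrite sup0.
apply: (@le_trans _ _ t); last exact: ub_le_sup.
by case: tx => s _ <-; exact: i01_ge0.
Qed.

Lemma fun_of_end_points_le1 x : fun_of_end_points x <= 1.
Proof.
rewrite /fun_of_end_points; have [->|/set0P[t tx]] :=
    eqVneq (i01val @` [set t | f t <= x <= g t]) set0.
  by rewrite sup0.
by apply: ge_sup; [exists t|move=> _ [s _ <-]; exact: i01_le1].
Qed.

Lemma fun_of_end_points_gt x (a : R) : 0 <= a -> a < fun_of_end_points x ->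
  exists2 t, a < i01val t & f t <= x <= g t.
Proof.
rewrite /fun_of_end_points; have [->|/set0P[b bx]] :=
    eqVneq (i01val @` [set t | f t <= x <= g t]) set0.
  by rewrite sup0 => a0; rewrite ltNge a0.
by move=> _ /sup_gt[|_ [t tx <-] at_]; [exists b|exists t].
Qed.

(** Nestedness puts $x$ in every interval of level $s < t$; left continuity of $f$ and $g$ then
    reaches $t$. *)
Lemma fun_of_end_pointsP t x : 0 < i01val t ->
  i01val t <= fun_of_end_points x <-> f t <= x <= g t.
Proof.
move=> t0; split=> [tx|]; last exact: fun_of_end_points_ge.
have lev s : i01val s < i01val t -> f s <= x <= g s.
  move=> st; have [r sr /andP[fx xg]] :=
    fun_of_end_points_gt (i01_ge0 s) (lt_le_trans st tx).
  by rewrite (le_trans (f_nd (ltW sr)) fx) (le_trans xg (g_ni (ltW sr))).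
apply/andP; split; first by apply: Cbar_left_le => // s /lev/andP[].
rewrite -lerN2; apply: (@Cbar_left_le _ (- g)) => // s /lev/andP[_ xg].
by change (- g s <= - x); rewrite lerN2.
Qed.

(** Superlevel sets at heights in $(0, 1]$ are the closed intervals $[f(t), g(t)]$: convexity gives
    quasi-concavity, closedness gives upper semicontinuity. *)
Lemma fun_of_end_points_fuzzy : is_fuzzy fun_of_end_points.
Proof.
have lev (a : R) : 0 < a -> a <= 1 ->
    exists t, forall x, a <= fun_of_end_points x <-> f t <= x <= g t.
  move=> a0 a1; have a01 : 0 <= a <= 1 by rewrite ltW.
  by exists (mkI01 a01) => x; rewrite -fun_of_end_pointsP.
split.
- by move=> x; rewrite fun_of_end_points_ge0 fun_of_end_points_le1.
- exists (f one01); apply/eqP; rewrite eq_le fun_of_end_points_le1/=.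
  by apply: (@fun_of_end_points_ge one01); rewrite lexx fg.
- move=> a x y /andP[a0 a1].
  set m := Num.min _ _; have [m0|m0] := leP m 0.
    exact: le_trans m0 (fun_of_end_points_ge0 _).
  have m1 : m <= 1 by rewrite ge_min fun_of_end_points_le1.
  have [t mP] := lev _ m0 m1.
  have /mP/andP[fx xg] : m <= fun_of_end_points x by rewrite ge_min lexx.
  have /mP/andP[fy yg] : m <= fun_of_end_points y by rewrite ge_min lexx orbT.
  apply/mP; apply/andP; split; nra.
- move=> x a xa.
  have a0 : 0 < a by apply: le_lt_trans xa; exact: fun_of_end_points_ge0.
  have [a1|a1] := ltP 1 a.
    by apply: filterE => y; apply: le_lt_trans a1; exact: fun_of_end_points_le1.
  have [t aP] := lev _ a0 a1.
  have : nbhs x (~` `[f t, g t]).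
    apply: open_nbhs_nbhs; split.
      by rewrite openC; exact: interval_closed.
    by rewrite /= in_itv/= => /aP; apply/negP; rewrite -ltNge.
  apply: filterS => y /=; rewrite in_itv/= => ny.
  by rewrite ltNge; apply/negP => /aP.
- apply: (@bounded_support_compact _ _ (uniform_norm f + uniform_norm g)) => x.
  move=> /(fun_of_end_points_gt (lexx 0))[t _ /andP[fx xg]].
  have := normC_ub f t; have := normC_ub g t.
  by rewrite !ler_norml => /andP[? ?] /andP[? ?]; apply/andP; split; lra.
Qed.

Lemma fuzzy_of_end_points : exists u, loC u = f /\ upC u = g.
Proof.
exists (MkFuzzy _ fun_of_end_points_fuzzy); apply: end_pointsP => // t x t0.
exact: fun_of_end_pointsP.
Qed.

End construction.

Fact in_Cbar_cst (c : R) : in_Cbar (fun=> c : R).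
Proof.
split; first by exists `|c|.
- by move=> t _; exact: cvg_cst.
- by move=> t _; exists c; exact: cvg_cst.
- exact: cvg_cst.
Qed.
Definition Cbar_cst (c : R) : Cbar R := MkCbar _ (asboolT (in_Cbar_cst c)).

(** The upper end is a constant $c$ and the lower end $f - c$. For increasing $f$, $c = f(1)/2$ is
    the least constant with $f - c \le c$, and it depends on $f$ in a Lipschitz way. *)
Definition sum_representative (f : Cbar R) u :=
  loC u = f - Cbar_cst (f one01 / 2) /\ upC u = Cbar_cst (f one01 / 2).

Lemma IC_sum_representative f : in_IC f -> exists u, sum_representative f u.
Proof.
move=> IC; apply: fuzzy_of_end_points.
- move=> s t st; change (f s - f one01 / 2 <= f t - f one01 / 2).
  by rewrite lerD2r IC.
- by move=> s t _; exact: lexx.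
- move=> t; change (f t - f one01 / 2 <= f one01 / 2).
  by have := IC t one01 (i01_le1 t); lra.
Qed.

Lemma sum_representativeE f u : sum_representative f u -> loC u + upC u = f.
Proof. by move=> [-> ->]; rewrite subrK. Qed.

(** The lower ends differ by at most $3/2$ of the norm and the upper ends by at most $1/2$; the
    factor $2$ is a round bound. *)
Lemma sum_representative_dist f g u v :
  sum_representative f u -> sum_representative g v ->
  fuzzy_dist u v <= 2 * uniform_norm (f - g).
Proof.
move=> [lu uu] [lv uv].
have ht t : `|f t - g t| <= uniform_norm (f - g) := normC_ub (f - g) t.
have h1 := ht one01.
apply: fuzzy_dist_le => t.
  have -> : lo u t = f t - f one01 / 2 := congr1 (fun w : Cbar R => w t) lu.
  have -> : lo v t = g t - g one01 / 2 := congr1 (fun w : Cbar R => w t) lv.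
  move: h1 (ht t); rewrite !ler_norml => /andP[? ?] /andP[? ?].
  by apply/andP; split; lra.
have -> : up u t = f one01 / 2 := congr1 (fun w : Cbar R => w t) uu.
have -> : up v t = g one01 / 2 := congr1 (fun w : Cbar R => w t) uv.
move: h1; rewrite !ler_norml => /andP[? ?].
by apply/andP; split; lra.
Qed.

Lemma sum_representative0 : sum_representative 0 fuzzy0.
Proof.
by split; rewrite (loC0, upC0); apply: Cbar_eq => t;
  [change (0 = 0 - 0 / 2 :> R)|change (0 = 0 / 2 :> R)]; rewrite mul0r ?subr0.
Qed.

Lemma sum_representative_norm f u : sum_representative f u ->
  fuzzy_norm u <= 2 * uniform_norm f.
Proof.
by move=> /sum_representative_dist/(_ sum_representative0); rewrite subr0.
Qed.

End fuzzy_of_end_points.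

(** * Passage to $p$-summable sequences *)

Section sequences.
Context {R : realType} (p : R) (p1 : 1 <= p).
Implicit Types (x y z : lpF p1) (s t : SpC p1).

(** The constant leaves the series as $c^p$ and the root turns it back into $c$. Both comparisons of
    [Psi] with [rho] are instances. *)
Lemma pow_series_root_le (c : R) (a b : nat -> R) : 0 <= c ->
  (forall n, 0 <= a n) -> (forall n, 0 <= b n) -> (forall n, a n <= c * b n) ->
  (pow_series p b < +oo)%E ->
  fine (pow_series p a) `^ p^-1 <= c * fine (pow_series p b) `^ p^-1.
Proof.
move=> c0 a0 b0 ab boo; have p0 : 0 < p := lt_le_trans ltr01 p1.
have bfin : pow_series p b \is a fin_num.
  by rewrite ge0_fin_numE ?pow_series_ge0.
have abE : (pow_series p a <= (c `^ p)%:E * pow_series p b)%E.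
  rewrite -nneseriesZl; last by move=> n _; rewrite lee_fin powR_ge0.
  apply: lee_nneseries => n _; first by rewrite lee_fin powR_ge0.
  rewrite -EFinM lee_fin -powRM//.
  by rewrite ge0_ler_powR ?nnegrE ?mulr_ge0// ltW.
have afin : pow_series p a \is a fin_num.
  rewrite ge0_fin_numE ?pow_series_ge0//; apply: le_lt_trans abE _.
  by rewrite -(fineK bfin) -EFinM ltry.
have -> : c = (c `^ p) `^ p^-1 by rewrite -powRrM mulfV ?gt_eqF// powRr1.
rewrite -powRM ?powR_ge0 ?fine_ge0 ?pow_series_ge0//.
rewrite ge0_ler_powR ?nnegrE ?invr_ge0 ?(ltW p0) ?fine_ge0 ?pow_series_ge0//.
  by rewrite mulr_ge0 ?powR_ge0 ?fine_ge0 ?pow_series_ge0.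
by rewrite -lee_fin EFinM !fineK.
Qed.

Lemma Psi_le_rho s t x y :
  (forall n, uniform_norm (s n - t n) <= fuzzy_dist (x n) (y n)) ->
  Psi s t <= rho x y.
Proof.
move=> st; rewrite -[leRHS]mul1r; apply: pow_series_root_le => //.
- by move=> n; exact: normC_ge0.
- by move=> n; exact: fuzzy_dist_ge0.
- by move=> n; rewrite mul1r.
- by rewrite -ge0_fin_numE ?pow_series_ge0// rho_fin.
Qed.

Lemma rho_le_Psi s t x y :
  (forall n, sum_representative (s n) (x n)) ->
  (forall n, sum_representative (t n) (y n)) ->
  rho x y <= 2 * Psi s t.
Proof.
move=> sx ty; apply: pow_series_root_le => //.
- by move=> n; exact: fuzzy_dist_ge0.
- by move=> n; exact: normC_ge0.
- by move=> n; exact: sum_representative_dist.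
- by rewrite -ge0_fin_numE ?pow_series_ge0// Psi_fin.
Qed.

Lemma SpIC_sum_representative s : SpIC s ->
  exists x, forall n, sum_representative (s n) (x n).
Proof.
move=> IC; have /choice[u su] n := IC_sum_representative (IC n).
have upE : (pow_series p (fun n => fuzzy_norm (u n)) < +oo)%E.
  apply: (le_pow_series p1 _ (fun n => sum_representative_norm (su n))).
    by move=> n; exact: fuzzy_norm_ge0.
  apply: pow_seriesZ => //; first by move=> n; exact: normC_ge0.
  exact/asboolP/SpC_seqP.
by exists (MkLpF p1 u upE).
Qed.

Lemma SpC_eq s t : (forall n, s n = t n) -> s = t.
Proof. by move=> st; apply: val_inj; exact/funext. Qed.

Lemma lpF_eq x y : (forall n, x n = y n) -> x = y.
Proof.
case: x y => x xp [y yp] /= /funext xy.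
by move: xp yp; rewrite xy => xp yp; congr MkLpF; exact: Prop_irrelevance.
Qed.

Definition end_points_sum x : SpC p1 := lpF_minus x + lpF_plus x.

Lemma lpF_minusD x y : lpF_minus (lpF_add x y) = lpF_minus x + lpF_minus y.
Proof. by apply: SpC_eq => n; have [] := end_points_add (x n) (y n). Qed.

Lemma lpF_plusD x y : lpF_plus (lpF_add x y) = lpF_plus x + lpF_plus y.
Proof. by apply: SpC_eq => n; have [] := end_points_add (x n) (y n). Qed.

Lemma end_points_sumD x y :
  end_points_sum (lpF_add x y) = end_points_sum x + end_points_sum y.
Proof. by rewrite /end_points_sum lpF_minusD lpF_plusD addrACA. Qed.

Lemma end_points_sumZ (a : R) x :
  end_points_sum (lpF_scale a x) = a *: end_points_sum x.
Proof. by apply: SpC_eq => n; exact: end_points_sum_scale. Qed.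

(** Exhibits $-x_+$ as a sequence of increasing functions. *)
Lemma lpF_minusN x : lpF_minus (lpF_scale (-1) x) = - lpF_plus x.
Proof.
rewrite -[- lpF_plus x]scaleN1r; apply: SpC_eq => n.
by have [] := end_points_scale_lt0 (x n) (ltrN10 R).
Qed.

                                                                        
(** Each level of $z_n$ has the form $[-b, b]$, which reflection in $0$ preserves. *)
Lemma lpF_scaleN1_id z : end_points_sum z = 0 -> lpF_scale (-1) z = z.
Proof.
move=> z0; apply: lpF_eq => n.
have /eqP : loC (z n) + upC (z n) = 0 := congr1 (fun w : SpC p1 => w n) z0.
rewrite addr_eq0 => /eqP luz.
have [lE uE] := end_points_scale_lt0 (z n) (ltrN10 R).
by apply: fuzzy_ext; [rewrite lE|rewrite uE]; rewrite scaleN1r luz ?opprK.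
Qed.

Lemma lpF_linear_eq0 (A : lpF p1 -> R) z : lpF_linear A ->
  end_points_sum z = 0 -> A z = 0.
Proof.
move=> [_ AZ] /lpF_scaleN1_id zN; have := AZ (-1) z; rewrite zN.
by lra.
Qed.

Lemma SpIC_lpF_minus x : SpIC (lpF_minus x).
Proof. by move=> n s t; apply: lo_le; exact: fuzzy_funP. Qed.

End sequences.

(** * The representation of continuous linear functionals *)

Theorem theorem3p4 (R : realType) (p : R) (p1 : 1 <= p) (xs : lpF p1 -> R) :
  (lpF_linear xs /\ metric_continuous_on (@rho R p p1) [set: lpF p1] xs) <->
  (exists L : {scalar SpC p1},
     (forall x : lpF p1, xs x = L (lpF_minus x + lpF_plus x)) /\
     metric_continuous_on (@Psi R p p1) (@SpIC R p p1) L).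
Proof.
split=> [[linA contA]|[L [AL contL]]].
  (* The graph of the functional that [xs] induces on the range of [end_points_sum]. *)
  pose G := [set q : SpC p1 * R | exists x, q = (end_points_sum x, xs x)].
  have [AD AZ] := linA.
  have linG : linear_relation G.
    move=> a _ _ _ _ [x [-> ->]] [y [-> ->]].
    exists (lpF_add (lpF_scale a x) y).
    by rewrite end_points_sumD end_points_sumZ AD AZ.
  have funG : functional_relation G.
    move=> c [x xc]; have x0 : end_points_sum x = 0 := esym (congr1 fst xc).
    have -> : c = xs x := congr1 snd xc.
    exact: lpF_linear_eq0 linA x0.
  have x0 : lpF p1.
    exists (fun=> fuzzy0).
    rewrite (_ : (fun _ => _) = (fun=> 0)); first exact: pow_series0.
    apply/funext => _; apply/eqP; rewrite eq_le fuzzy_norm_ge0 andbT.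
    have := sum_representative_norm (@sum_representative0 R).
    by rewrite normC0 mulr0.
  have G0 : G !=set0 by exists (end_points_sum x0, xs x0); exists x0.
  have [L LG] := linear_extension linG funG G0.
  have LE x : L (end_points_sum x) = xs x by apply: LG; exists x.
  exists L; split=> [x|s ICs e e0]; first exact/esym/LE.
  have Lrep (t : SpC p1) (y : lpF p1) :
      (forall n, sum_representative (t n) (y n)) -> L t = xs y.
    move=> ty; rewrite -LE; congr (L _); apply: SpC_eq => n.
    exact/esym/sum_representativeE.
  have [x sx] := SpIC_sum_representative ICs.
  have [d d0 xd] := contA x I e e0.
  (* The $2$ is the Lipschitz constant of the choice of representatives in [rho_le_Psi]. *)
  exists (d / 2) => [|t ICt st]; first by rewrite divr_gt0.
  have [y ty] := SpIC_sum_representative ICt.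
  rewrite (Lrep _ _ sx) (Lrep _ _ ty); apply: xd => //.
  apply: le_lt_trans (rho_le_Psi sx ty) _.
  by rewrite mulrC -ltr_pdivlMr.
(* The terms of $x_+$ are decreasing, so continuity of [L] does not apply to it directly; both
   arguments here lie in [SpIC]. *)
have AE x : xs x = L (lpF_minus x) - L (lpF_minus (lpF_scale (-1) x)).
  by rewrite lpF_minusN raddfN opprK AL raddfD.
split; first split.
- by move=> x y; rewrite !AL -raddfD -/(end_points_sum _) end_points_sumD.
- by move=> a x; rewrite !AL -/(end_points_sum _) end_points_sumZ linearZ.
move=> x _ e e0; have e20 : 0 < e / 2 by rewrite divr_gt0.
have [d1 d10 xd1] := contL _ (SpIC_lpF_minus x) _ e20.
have [d2 d20 xd2] := contL _ (SpIC_lpF_minus (lpF_scale (-1) x)) _ e20.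
exists (Num.min d1 d2) => [|y _]; first by rewrite lt_min d10.
rewrite lt_min => /andP[xy1 xy2].
have P1 : Psi (lpF_minus x) (lpF_minus y) < d1.
  by apply: le_lt_trans xy1; apply: Psi_le_rho => n; exact: fuzzy_dist_lo.
have P2 :
    Psi (lpF_minus (lpF_scale (-1) x)) (lpF_minus (lpF_scale (-1) y)) < d2.
  apply: le_lt_trans xy2; apply: Psi_le_rho => n; rewrite !lpF_minusN.
  change (uniform_norm (- upC (x n) - - upC (y n)) <= fuzzy_dist (x n) (y n)).
  rewrite -opprD; apply: le_trans (fuzzy_dist_up _ _).
  apply: normC_le => r.
  by have := normC_ub (upC (x n) - upC (y n)) r; rewrite -normrN.
have h2 := xd2 _ (SpIC_lpF_minus (lpF_scale (-1) y)) P2.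
have h1 := xd1 _ (SpIC_lpF_minus y) P1.
rewrite !AE opprD addrACA -opprD [ltRHS]splitr.
exact: le_lt_trans (ler_normB _ _) (ltrD h1 h2).
Qed.
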